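(* Let $X$ and $Y$ be Polish spaces and let $f\colon X\to Y$ be an arbitrary function. The game $G'_f$ is determined (i.e. one of the two players has a winning strategy), and \begin{itemize} \item Player I has a winning strategy in $G'_f$ if and only if $f$ is not of Baire class 1; \item Player II has a winning strategy in $G'_f$ if and only if $f$ is of Baire class 1. \end{itemize}
   Context: $X$ and $Y$ are Polish spaces with fixed compatible complete metrics $d_X$ and $d_Y$. A function $f\colon X\to Y$ is of Baire class 1 if $f^{-1}[U]$ is $F_\sigma$ in $X$ for every open $U\subseteq Y$. The game $G'_f$: at step $n\in\mathbb{N}=\{0,1,2,\dots\}$ Player I plays $x_n$ and then Player II plays $x'_n$ (order of moves: $x_0,x'_0,x_1,x'_1,\dots$), with the rules that for each $n$: $x_n\in X$ and $d_X(x_n,x_{n+1})\le 2^{-n}$; and $x'_n\in X$. Since $X$ is complete, $x_n\to x$ for some $x\in X$. Player II wins if the sequence $\langle f(x'_n)\rangle$ converges to $f(x)$; otherwise Player I wins. The rules are binding: the first player who does not make a legal move loses. The Axiom of Choice is assumed. *)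

(* Defs.v *)
From HB Require Import structures.
From mathcomp Require Import all_boot all_order all_algebra.
From mathcomp Require Import boolp classical_sets cardinality reals.
From mathcomp Require Import topology borel_hierarchy.

Set Implicit Arguments.
Unset Strict Implicit.
Unset Printing Implicit Defensive.

Import Order.TTheory GRing.Theory Num.Theory.
Local Open Scope classical_set_scope.
Local Open Scope ring_scope.

Definition separable (T : topologicalType) : Prop :=
  exists2 D : set T, countable D & dense D.

(* The library's [completeType] is pointed; completeness is stated here as a
   property of a metric space so that the empty space is allowed. *)
Definition complete_metric (R : realType) (T : metricType R) : Prop :=
  forall u : nat -> T, cauchy (u @ \oo) -> exists l : T, u @ \oo --> l.

(* A Polish space together with a fixed compatible complete metric: the topology
   of a [metricType] is the one induced by [mdist]. *)
Definition polish_metric (R : realType) (T : metricType R) : Prop :=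
  complete_metric T /\ separable T.

Definition baire_class1 (X Y : topologicalType) (f : X -> Y) : Prop :=
  forall U : set Y, open U -> Fsigma (f @^-1` U).

Section game.
Context {R : realType} {X Y : metricType R}.
Implicit Types f : X -> Y.

(* Player II has no constraint beyond playing points of X. *)
Definition legal (x : nat -> X) : Prop := forall n, mdist (x n) (x n.+1) <= 2 ^- n.

(* A run is recorded as the pair (x, x') of the two players' move sequences.
   If x is not legal then Player I is the first player to break the rules, so
   that Player II wins, whatever the later moves are. *)
Definition winsII f (x x' : nat -> X) : Prop :=
  legal x -> exists2 l : X, x @ \oo --> l & (f \o x') @ \oo --> f l.

Definition winsI f (x x' : nat -> X) : Prop := ~ winsII f x x'.

(* A strategy computes a player's n-th move from the opponent's earlier moves:
   these are n in number for Player I (who moves first) and n.+1 for Player II.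
   When X is empty Player I has no strategy and Player II has exactly one, in
   accordance with Player I losing at once for want of a legal move. *)
Definition strategyI : Type := forall n, n.-tuple X -> X.
Definition strategyII : Type := forall n, n.+1.-tuple X -> X.

Definition followsI (s : strategyI) (x x' : nat -> X) : Prop :=
  forall n, x n = s n [tuple x' i | i < n].

Definition followsII (t : strategyII) (x x' : nat -> X) : Prop :=
  forall n, x' n = t n [tuple x i | i < n.+1].

Definition I_has_winning_strategy f : Prop :=
  exists s : strategyI, forall x x', followsI s x x' -> winsI f x x'.

Definition II_has_winning_strategy f : Prop :=
  exists t : strategyII, forall x x', followsII t x x' -> winsII f x x'.

End game.

(* Main.v *)
Require Import Defs.
From mathcomp Require Import all_boot all_order all_algebra.
From mathcomp Require Import boolp classical_sets cardinality reals.
From mathcomp Require Import topology borel_hierarchy.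
From mathcomp Require Import interval_inference num_normedtype lra.

(** Everything goes through one reformulation of the first Baire class:
    [countably_fine f] says that for each e > 0 the space X is covered by
    countably many closed sets on each of which f oscillates by less than e.

    For Y separable this is equivalent to f being of Baire class 1
    ([baire_class1_countably_fine], [countably_fine_baire_class1]): the preimages
    of the e/2-balls around a countable dense set are Fsigma and cover X;
    conversely the preimage of an open U is the union of those pieces, over all
    the precisions 2^-n, whose image lies in U.

    If f is countably fine, fix such a cover for every precision 2^-i.  The
    moves x_0, ..., x_n confine the limit l to a closed ball around x_n.  For
    each i, Player II guesses the first piece of the i-th cover that meets this
    ball; as the pieces are closed, the guess is eventually the first piece that
    contains l.  Answering with a point in as many of the guessed pieces as
    possible makes f(x'_n) converge to f(l) ([II_wins_of_pieces]).

    If f is not countably fine, some precision 2e fails.  Remove from X every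
    basic ball that does have a countable cover of precision 2e: what remains is
    a nonempty set F, and arbitrarily close to each point x of F there is a
    y in F with f(y) at distance at least e from f(x)
    ([not_finely_covered_jump]).  Player I stays at a point of F until Player II
    answers with a value close to that of f there, and then jumps to such a y.
    Finitely many jumps leave f(x'_n) away from f(l), infinitely many make
    f(x'_n) oscillate, so Player I wins ([I_wins_of_jumps]).

    Since the two players cannot both have winning strategies
    ([not_both_win]), the two implications are equivalences. *)

Set Implicit Arguments.
Unset Strict Implicit.
Unset Printing Implicit Defensive.

Import Order.TTheory GRing.Theory Num.Theory.
Import metricType_numDomainType.
Local Open Scope classical_set_scope.
Local Open Scope ring_scope.

(** * Balls and limits in metric spaces *)

Section metric.
Context {R : realType} {T : metricType R}.
Implicit Types (x y : T) (P : set T).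

Definition cball x (r : R) : set T := [set y | mdist x y <= r].

Lemma mball_open x (e : R) : open [set y | mdist x y < e].
Proof.
rewrite openE => y /= xye; apply/nbhs_ballP; exists (e - mdist x y) => /=.
  by rewrite subr_gt0.
rewrite ballEmdist => z /= yz; have := metric_triangle x y z; lra.
Qed.

Lemma cball_closed x r : closed (cball x r).
Proof.
rewrite -openC openE => y /= /negP; rewrite -ltNge => xyr.
apply/nbhs_ballP; exists (mdist x y - r) => /=; first by rewrite subr_gt0.
rewrite ballEmdist => z /= yz; apply/negP; rewrite -ltNge.
have := metric_triangle x z y; rewrite (metric_sym z y); lra.
Qed.

Lemma closed_avoid P x : closed P -> ~ P x ->
  exists2 r : R, 0 < r & forall y, mdist x y < r -> ~ P y.
Proof.
move=> /closed_openC; rewrite openE => /(_ x)/[apply] /nbhs_ballP[r /= r0].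
by rewrite ballEmdist => h; exists r.
Qed.

Lemma dense_near (D : set T) x (e : R) : dense D -> 0 < e ->
  exists2 a, D a & mdist a x < e.
Proof.
move=> dD e0; have [|a [/= xa Da]] := dD _ _ (mball_open x e).
  by exists x; rewrite /= mdistxx.
by exists a => //; rewrite metric_sym.
Qed.

Lemma lim_mdist_le (u : nat -> T) (l a : T) N (r : R) :
  u @ \oo --> l -> (forall n, (N <= n)%N -> mdist a (u n) <= r) ->
  mdist a l <= r.
Proof.
move=> /cvgrPdist_lt ul aur; apply/ler_addgt0Pl => e e0.
have [M _ /(_ (maxn N M))/= h] := ul e e0.
have := metric_triangle a (u (maxn N M)) l.
have := aur _ (leq_maxl N M); have := h (leq_maxr N M).
rewrite (metric_sym l); lra.
Qed.
End metric.

Lemma pow2V_lt (R : realType) (e : R) : 0 < e -> exists n, 2 ^- n < e.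
Proof.
move=> e0; have [N _ /(_ N (leqnn N))/=] := near_infty_natSinv_expn_lt (PosNum e0).
by rewrite div1r; exists N.
Qed.

Lemma exprVS (R : realType) n : (2 : R) ^- n = 2 * 2 ^- n.+1.
Proof. by rewrite exprS invfM mulrA mulfV ?mul1r. Qed.

(** * Legal sequences of moves of Player I *)

Section legal.
Context {R : realType} {X : metricType R}.
Variable x : nat -> X.
Hypothesis lx : legal x.

Lemma legal_dist n m : (n <= m)%N -> mdist (x n) (x m) <= 2 * 2 ^- n.
Proof.
move=> nm; rewrite -(subnK nm); move: (m - n)%N => k {m nm}; elim: k n => [|m IH] n.
  by rewrite mdistxx mulr_ge0// invr_ge0 exprn_ge0.
rewrite addSnnS; have := metric_triangle (x n) (x n.+1) (x (m + n.+1)%N).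
have := IH n.+1; have := lx n; rewrite -exprVS; lra.
Qed.

Lemma legal_cvg : complete_metric X -> exists l : X, x @ \oo --> l.
Proof.
apply; apply: cauchy_exP => e e0.
have [n ne] := @pow2V_lt R (e / 2) ltac:(lra).
exists (x n), n => // m /= nm; rewrite ballEmdist /=.
have := legal_dist nm; lra.
Qed.

Lemma legal_lim (l : X) n : x @ \oo --> l -> mdist (x n) l <= 2 * 2 ^- n.
Proof. by move=> xl; apply: (lim_mdist_le (N := n) xl) => m /legal_dist. Qed.
End legal.

(** * Countable families of closed sets *)

(** The value [set0] fills the places that carry no element of [C], so that the
    empty family is enumerated as well. *)
Lemma countable_enum T (C : set (set T)) : countable C ->
  exists P : nat -> set T,
    (forall k, C (P k) \/ P k = set0) /\ (forall Q, C Q -> exists k, P k = Q).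
Proof.
move=> /countable_injP[g gI]; exists (fun k => xget set0 [set Q | C Q /\ g Q = k]).
split=> [k|Q CQ]; first by case: xgetP => [Q -> [CQ _]|_]; [left|right].
exists (g Q); case: xgetP => [Q' _ [CQ' e]|/(_ Q)[]//].
by apply: gI => //; rewrite inE.
Qed.

Lemma countable_bigcup_Fsigma (T : topologicalType) (C : set (set T)) :
  countable C -> (forall P, C P -> closed P) -> Fsigma (\bigcup_(P in C) P).
Proof.
move=> /countable_enum[P [PC CP]] Ccl; exists P => [k|].
  by have [/Ccl//|->] := PC k; exact: closed0.
apply/seteqP; split=> [x [Q /CP[k <-] Px]|x [k _ Px]]; first by exists k.
by have [CPk|P0] := PC k; [exists (P k)|rewrite P0 in Px].
Qed.

(** * Baire class 1 and covers by closed sets of small oscillation *)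

Section cover.
Context {R : realType} {X Y : metricType R}.
Variable f : X -> Y.
Implicit Types (e : R) (A P : set X).

Definition fine e P := forall y z, P y -> P z -> mdist (f y) (f z) < e.

Definition finely_covered e A := exists2 C : set (set X), countable C &
  (forall P, C P -> closed P /\ fine e P) /\ A `<=` \bigcup_(P in C) P.

Definition countably_fine := forall e, 0 < e -> finely_covered e setT.

Lemma finely_covered_closed e P : closed P -> fine e P -> finely_covered e P.
Proof.
by move=> cP fP; exists [set P]; [exact: countable1|split=> [_ ->//|x Px]; exists P].
Qed.

Lemma finely_covered_sub e A B : A `<=` B -> finely_covered e B -> finely_covered e A.
Proof. by move=> AB [C cC [CP BC]]; exists C => //; split=> // x /AB/BC. Qed.

Lemma finely_covered_bigcup I (D : set I) (A : I -> set X) e : countable D ->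
  (forall i, D i -> finely_covered e (A i)) ->
  finely_covered e (\bigcup_(i in D) A i).
Proof.
move=> cD Afine.
have /choice[C CP] : forall i, exists Ci : set (set X), D i -> countable Ci /\
    (forall P, Ci P -> closed P /\ fine e P) /\ A i `<=` \bigcup_(P in Ci) P.
  move=> i; have [Di|nDi] := pselect (D i); last by exists set0.
  by have [Ci cCi hCi] := Afine i Di; exists Ci.
exists (\bigcup_(i in D) C i).
  by apply: bigcup_countable => // i /CP[].
split=> [P [i Di CiP]|x [i Di Aix]]; first by have [_ [+ _]] := CP i Di; apply.
have [_ [_ /(_ x Aix)[P CiP Px]]] := CP i Di.
by exists P => //; exists i.
Qed.

Lemma finely_covered_seq e A : finely_covered e A -> exists P : nat -> set X,
  (forall k, closed (P k) /\ fine e (P k)) /\ A `<=` \bigcup_k P k.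
Proof.
move=> [C /countable_enum[P [PC CP]] [Ccf AC]]; exists P.
split=> [k|x /AC[Q /CP[k <-] Pkx]].
  by have [/Ccf//|->] := PC k; split=> //; exact: closed0.
by exists k.
Qed.

(** The preimages of the balls of radius [e / 2] around a countable dense subset
    of Y are Fsigma, and f oscillates by less than [e] on each of them. *)
Lemma baire_class1_countably_fine :
  separable Y -> baire_class1 f -> countably_fine.
Proof.
move=> [D cD dD] bf e e0.
apply: (@finely_covered_sub _ _
    (\bigcup_(a in D) f @^-1` [set y | mdist a y < e / 2])).
  move=> x _.
  by have [//||a Da afx] := @dense_near _ _ D (f x) (e / 2); [lra|exists a].
apply: finely_covered_bigcup => // a Da.
have [F cF FE] := bf _ (mball_open a (e / 2)); rewrite FE.
apply: finely_covered_bigcup => // k _; apply: finely_covered_closed => // y z Fy Fz.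
have [/= ay az] : (f @^-1` [set y | mdist a y < e / 2]) y /\
                  (f @^-1` [set y | mdist a y < e / 2]) z.
  by rewrite FE; split; exists k.
have := metric_triangle (f y) a (f z); rewrite (metric_sym (f y) a); lra.
Qed.

(** If f(x) is in the open set U, then so is the image of any piece that contains
    x and is finer than the radius of some ball around f(x) inside U.  Thus the
    preimage of U is a union of pieces, taken from countably many covers. *)
Lemma countably_fine_baire_class1 : countably_fine -> baire_class1 f.
Proof.
move=> cf U oU.
have /choice[C CP] : forall n, exists C : set (set X), countable C /\
    (forall P, C P -> closed P /\ fine (2 ^- n) P) /\ setT `<=` \bigcup_(P in C) P.
  by move=> n; have [|C cC hC] := cf (2 ^- n); [rewrite invr_gt0 exprn_gt0|exists C].
pose K := (\bigcup_n C n) `&` [set P | P `<=` f @^-1` U].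
have -> : f @^-1` U = \bigcup_(P in K) P.
  apply/seteqP; split=> [x fxU|x [P [_ PU]] /PU//].
  have := oU; rewrite openE => /(_ _ fxU)/nbhs_ballP[r /= r0].
  rewrite ballEmdist => rU.
  have [n nr] := pow2V_lt r0; have [_ [Cf /(_ x I)[P CnP Px]]] := CP n.
  exists P => //; split; first by exists n.
  by move=> y Py; apply: rU => /=; apply: lt_trans nr; apply: (Cf P CnP).2.
apply: countable_bigcup_Fsigma.
  apply: sub_countable (subset_card_le (@subIsetl _ _ _)) _.
  by apply: bigcup_countable => // n _; have [] := CP n.
by move=> P [[n _ CnP] _]; have [_ [/(_ P CnP)[]]] := CP n.
Qed.

(** The witness F is the complement of the union O of the basic open balls whose
    closed versions are finely covered.  O is finely covered, being a countable
    union of finely covered sets, hence F is not empty.  If f stayed within [e] of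
    f(x) on F near a point x of F, then the part of F inside a small basic closed
    ball around x would be one more piece of precision [2 * e]; with the cover of
    O it would cover the whole ball, and x would lie in O.  This one-step argument
    replaces the transfinite iteration of a Cantor-Bendixson derivative. *)
Lemma not_finely_covered_jump e : 0 < e -> separable X ->
  ~ finely_covered (2 * e) setT ->
  exists2 F : set X, F !=set0 & forall x (d : R), F x -> 0 < d ->
    exists y, [/\ F y, mdist x y <= d & e <= mdist (f x) (f y)].
Proof.
move=> e0 [D cD dD] nfc.
pose G := [set p : X * nat | D p.1 /\ finely_covered (2 * e) (cball p.1 (2 ^- p.2))].
pose O := \bigcup_(p in G) [set y | mdist p.1 y < 2 ^- p.2].
have cG : countable G.
  apply: sub_countable (countableX cD (countableP [set: nat])).
  by apply: subset_card_le => p [].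
have fcO : finely_covered (2 * e) O.
  apply: finely_covered_sub (finely_covered_bigcup cG (fun p => @proj2 _ _)).
  by move=> y [p Gp /ltW py]; exists p.
have oO : open O by apply: bigcup_open => p _; exact: mball_open.
exists (~` O).
  apply: contrapT => /set0P/negP/negPn/eqP nO; apply: nfc.
  by apply: finely_covered_sub fcO => x _; apply: contrapT => Ox;
    rewrite -[False]/(set0 x) -nO.
move=> x d nOx d0; apply: contrapT => nex.
have near_e y : ~ O y -> mdist x y <= d -> mdist (f x) (f y) < e.
  by move=> nOy xy; rewrite ltNge; apply/negP => exy; apply: nex; exists y.
apply: nOx; have [j jd] := @pow2V_lt R (d / 2) ltac:(lra).
have [//||a Da ax] := @dense_near _ _ D x (2 ^- j); first by rewrite invr_gt0 exprn_gt0.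
exists (a, j) => //; split=> //=.
have ad y : cball a (2 ^- j) y -> mdist x y <= d.
  rewrite /cball /=; have := metric_triangle x a y; rewrite (metric_sym x a); lra.
(* The closed ball is covered by O together with its own trace on F. *)
pose B b := if b then O else cball a (2 ^- j) `&` ~` O.
apply: (@finely_covered_sub _ _ (\bigcup_b B b)).
  by move=> y ay; have [Oy|nOy] := pselect (O y); [exists true|exists false].
apply: finely_covered_bigcup => // -[] _ //=; apply: finely_covered_closed.
  by apply: closedI; [exact: cball_closed|exact: open_closedC].
move=> y z [/ad xy nOy] [/ad xz nOz].
have := near_e y nOy xy; have := near_e z nOz xz.
have := metric_triangle (f y) (f x) (f z); rewrite (metric_sym (f y) (f x)); lra.
Qed.

End cover.

(** * A winning strategy for Player II *)

Section playerII.
Context {R : realType} {X Y : metricType R}.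
Variables (f : X -> Y) (P : nat -> nat -> set X).
Hypothesis Pclosed : forall i j, closed (P i j).
Hypothesis Pcover : forall i x, exists j, P i j x.

(** Later legal moves stay within 2^-n + 2^-(n+1) + ... = 2 * 2^-n of [x], so this
    closed ball is where the limit can still be after Player I's move [x] in
    round [n]. *)
Definition meets n x i j := (cball x (2 * 2 ^- n) `&` P i j) !=set0.

Lemma meets_ex n x i : exists j, `[< meets n x i j >].
Proof.
have [j Pj] := Pcover i x; exists j; apply/asboolP; exists x; split=> //.
by rewrite /cball /= mdistxx mulr_ge0// invr_ge0 exprn_ge0.
Qed.

Definition piece n x i := ex_minn (meets_ex n x i).

(** The ball around [x n] always contains [l], so every piece containing [l] is
    met; a piece that misses [l] is closed, so it is at a positive distance from
    [l] and the shrinking balls eventually avoid it. *)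
Lemma piece_stable (x : nat -> X) (l : X) i : legal x -> x @ \oo --> l ->
  exists2 j, P i j l & \forall n \near \oo, piece n (x n) i = j.
Proof.
move=> lx xl.
have ex : exists j, `[< P i j l >].
  by have [j Pj] := Pcover i l; exists j; apply/asboolP.
case: (ex_minnP ex) => j /asboolP Pj jmin; exists j => //.
have miss (j' : 'I_j) : \forall n \near \oo, ~ meets n (x n) i j'.
  have nP : ~ P i j' l by move=> /asboolP/jmin; rewrite leqNgt ltn_ord.
  have [r r0 rP] := closed_avoid (@Pclosed i j') nP.
  have [N Nr] := @pow2V_lt R (r / 4) ltac:(lra).
  exists N => // n /= Nn [z [/= xz]]; apply: rP.
  have nN : (2 : R) ^- n <= 2 ^- N.
    by rewrite lef_pV2 ?posrE ?exprn_gt0// ler_eXn2l ?ltr1n.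
  move: xz (legal_lim lx n xl) (metric_triangle l (x n) z).
  rewrite /cball /= (metric_sym l (x n)); lra.
apply: filterS (filter_forall _ miss) => n nmeets; rewrite /piece.
case: ex_minnP => k /asboolP mk kmin; apply/eqP; rewrite eqn_leq kmin /=.
  by rewrite leqNgt; apply/negP => kj; apply: (nmeets (Ordinal kj)).
by apply/asboolP; exists l; split=> //; exact: legal_lim.
Qed.

Definition in_pieces n x k z := forall i, (i < k)%N -> P i (piece n x i) z.

(** The guessed pieces of the first covers may fail to have a common point while
    the guesses are still wrong; the reply satisfies the longest initial segment
    of the guesses that is satisfiable, up to precision [n]. *)
Lemma best_reply n x : exists z, forall k, (k <= n)%N ->
  (exists z', in_pieces n x k z') -> in_pieces n x k z.
Proof.
pose p k := (k <= n)%N && `[< exists z, in_pieces n x k z >].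
have p0 : exists k, p k by exists 0%N; rewrite /p /=; apply/asboolP; exists x.
have pn k : p k -> (k <= n)%N by case/andP.
case: (ex_maxnP p0 pn) => m /andP[_ /asboolP[z mz]] mmax; exists z => k kn hk i ik.
by apply: mz; apply: leq_trans ik (mmax k _); rewrite /p kn; apply/asboolP.
Qed.

Hypothesis Pfine : forall i j, fine f (2 ^- i) (P i j).

(** Once the guesses for the covers [0, ..., k] are right, [l] itself is a common
    point of the guessed pieces, so the reply shares with [l] a piece on which f
    oscillates by less than [2 ^- k]. *)
Lemma II_wins_of_pieces : complete_metric X -> II_has_winning_strategy f.
Proof.
move=> cX.
have /choice[g gP] := fun p : nat * X => best_reply p.1 p.2.
exists (fun n w => g (n, tnth w ord_max)) => x x' fol lx.
have [l xl] := legal_cvg lx cX; exists l => //.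
have /choice[j jP] : forall i, exists j, P i j l /\
    \forall n \near \oo, piece n (x n) i = j.
  by move=> i; have [j] := piece_stable i lx xl; exists j.
apply/cvgrPdist_lt => e e0; have [k ke] := pow2V_lt e0.
have pn : \forall n \near \oo, forall i : 'I_k.+1, piece n (x n) i = j i.
  by apply: filter_forall => i; have [] := jP i.
near=> n; rewrite /= fol tnth_mktuple; apply: lt_trans ke.
have pnj i : (i < k.+1)%N -> piece n (x n) i = j i.
  by move=> ik; apply: (near pn n _ (Ordinal ik)).
apply: (@Pfine k (j k)); first by have [] := jP k.
rewrite -pnj//; apply: (gP (n, x n) k.+1) => //=.
  by near: n; exact: nbhs_infty_ge.
by exists l => i ik; rewrite pnj//; have [] := jP i.
Unshelve. all: by end_near. Qed.

End playerII.

(** * A winning strategy for Player I *)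

Section playerI.
Context {R : realType} {X Y : metricType R}.
Variables (f : X -> Y) (e : R).

(** Player I's position after [n] rounds: stay put, except for jumping as soon as
    Player II's answer has a value within [e / 3] of that at the current
    position. *)
Fixpoint run (x0 : X) (jump : nat -> X -> X) (x' : nat -> X) n :=
  if n is m.+1 then
    let x := run x0 jump x' m in
    if mdist (f (x' m)) (f x) < e / 3 then jump m x else x
  else x0.

Lemma run_ext x0 jump x' x'' n : (forall i, (i < n)%N -> x' i = x'' i) ->
  run x0 jump x' n = run x0 jump x'' n.
Proof.
elim: n => //= n IH h; rewrite IH ?h// => i ni; apply: h; exact: ltnW.
Qed.

(** Suppose that x_n tends to [l] and f(x'_n) to f(l), and consider only rounds
    where f(x'_n) is within [e / 6] of f(l).  A position whose value is at least
    [e / 2] away from f(l) is never left, as f(x'_n) cannot come within [e / 3] of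
    it; it would then be [l], which is absurd.  So all positions have values
    within [e / 2] of f(l), and no jump, which changes the value by [e], takes
    place.  Hence the position is constantly [l], while f(x'_n) within [e / 6] of
    f(l) triggers a jump. *)
Lemma I_wins_of_jumps (F : set X) : 0 < e -> F !=set0 ->
  (forall x (d : R), F x -> 0 < d ->
    exists y, [/\ F y, mdist x y <= d & e <= mdist (f x) (f y)]) ->
  I_has_winning_strategy f.
Proof.
move=> e0 [x0 Fx0] jumpF.
have /choice[jump jumpP] : forall n, exists jump : X -> X, forall x, F x ->
    [/\ F (jump x), mdist x (jump x) <= 2 ^- n & e <= mdist (f x) (f (jump x))].
  move=> n; suff /choice[jump jumpP] : forall x, exists y, F x ->
      [/\ F y, mdist x y <= 2 ^- n & e <= mdist (f x) (f y)] by exists jump.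
  move=> x; have [Fx|nFx] := pselect (F x); last by exists x.
  have [|y yP] := jumpF x (2 ^- n) Fx; last by exists y.
  by rewrite invr_gt0 exprn_gt0.
(* [run] consults only the first [n] answers, so the default is never read. *)
exists (fun n w => run x0 jump (nth x0 w) n) => x x' fol.
have xE n : x n = run x0 jump x' n.
  rewrite fol; apply: run_ext => i ni.
  by rewrite -[i]/(nat_of_ord (Ordinal ni)) -tnth_nth tnth_mktuple.
have xS n : x n.+1 = if mdist (f (x' n)) (f (x n)) < e / 3 then jump n (x n) else x n.
  by rewrite !xE.
have Fx n : F (x n).
  elim: n => [|n IH]; first by rewrite xE.
  by rewrite xS; case: ifP => // _; have [] := jumpP n _ IH.
have lx : legal x.
  move=> n; rewrite xS; case: ifP => _; first by have [] := jumpP n _ (Fx n).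
  by rewrite mdistxx invr_ge0 exprn_ge0.
move=> /(_ lx)[l xl /cvgrPdist_lt fl].
have [N _ /= Nl] := fl (e / 6) ltac:(lra).
have const n : (forall m, (n <= m)%N -> x m = x n -> x m.+1 = x n) -> l = x n.
  move=> stay.
  have xc m : (n <= m)%N -> x m = x n.
    by move=> /subnK <-; elim: (m - n)%N => // k IH; apply: stay IH; exact: leq_addl.
  apply/esym/mdist_positivity/eqP; rewrite eq_le mdist_ge0 andbT.
  by apply: (lim_mdist_le (N := n) xl) => m /xc ->; rewrite mdistxx.
have close n : (N <= n)%N -> mdist (f l) (f (x n)) < e / 2.
  move=> Nn; rewrite ltNge; apply/negP => far.
  suff lE : l = x n by move: far; rewrite lE mdistxx; lra.
  apply: const => m nm xm; rewrite xS xm ifF//; apply/negbTE; rewrite -leNgt.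
  have := Nl m (leq_trans Nn nm).
  have := metric_triangle (f l) (f (x' m)) (f (x n)); lra.
have nojump n : (N <= n)%N -> e / 3 <= mdist (f (x' n)) (f (x n)).
  move=> Nn; rewrite leNgt; apply/negP => jn.
  have := close n.+1 (leqW Nn); rewrite xS jn.
  have [_ _] := jumpP n _ (Fx n); have := close n Nn.
  have := metric_triangle (f (x n)) (f l) (f (jump n (x n))).
  rewrite (metric_sym (f (x n)) (f l)); lra.
have lN : l = x N.
  by apply: const => m Nm xm; rewrite xS ifF//; apply/negbTE; rewrite -leNgt nojump.
have := nojump N (leqnn N); have := Nl N (leqnn N).
rewrite lN metric_sym; lra.
Qed.
End playerI.

(** * The players cannot both win *)

(** Recursion on the whole history: [a n] below is correct at the indices less
    than [n], and [a n.+1] corrects it at [n]. *)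
Lemma course_of_values (T : Type) (x0 : T) (G : nat -> (nat -> T) -> T) :
  (forall n u v, (forall i, (i < n)%N -> u i = v i) -> G n u = G n v) ->
  exists u, forall n, u n = G n u.
Proof.
move=> Gext.
pose a := fix a n := if n is m.+1 then
  fun i => if i == m then G m (a m) else a m i else fun=> x0.
have aE n i : (i < n)%N -> a n i = a i.+1 i.
  elim: n => // n IH; rewrite ltnS leq_eqVlt => /predU1P[->//|ni] /=.
  by rewrite (ltn_eqF ni) IH //= eqxx.
exists (fun n => a n.+1 n) => n /=; rewrite eqxx.
by apply: Gext => i /aE.
Qed.

(** Letting the two strategies play against each other produces a run that both
    would win. *)
Lemma not_both_win (R : realType) (X Y : metricType R) (f : X -> Y) :
  I_has_winning_strategy f -> ~ II_has_winning_strategy f.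
Proof.
move=> [s sP] [t tP].
pose sx (u : nat -> X) n := s n [tuple u i | i < n].
have [|x' x'P] := @course_of_values X (s 0%N [tuple])
    (fun n u => t n [tuple sx u i | i < n.+1]).
  move=> n u v uv; congr t; apply: eq_from_tnth => i; rewrite !tnth_mktuple.
  congr s; apply: eq_from_tnth => j; rewrite !tnth_mktuple uv//.
  exact: leq_trans (ltn_ord j) (ltn_ord i : (i <= n)%N).
by apply: (sP (sx x') x') => //; apply: tP.
Qed.

(** * Determinacy of the game *)

Theorem theorem6 (R : realType) (X Y : metricType R)
  (polX : polish_metric X) (polY : polish_metric Y) (f : X -> Y) :
  (I_has_winning_strategy f \/ II_has_winning_strategy f) /\
  (I_has_winning_strategy f <-> ~ baire_class1 f) /\
  (II_has_winning_strategy f <-> baire_class1 f).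
Proof.
have [cX sX] := polX; have [_ sY] := polY.
have winII : baire_class1 f -> II_has_winning_strategy f.
  move=> /(baire_class1_countably_fine sY) cf.
  have /choice[P PP] : forall i, exists P : nat -> set X,
      (forall k, closed (P k) /\ fine f (2 ^- i) (P k)) /\ setT `<=` \bigcup_k P k.
    by move=> i; apply/finely_covered_seq/cf; rewrite invr_gt0 exprn_gt0.
  apply: (@II_wins_of_pieces _ _ _ f P) => // [i j|i x|i j].
  - by have [/(_ j)[]] := PP i.
  - by have [_ /(_ x I)[j _ Pj]] := PP i; exists j.
  - by have [/(_ j)[]] := PP i.
have winI : ~ baire_class1 f -> I_has_winning_strategy f.
  move=> nbf; have [e e0 nfc] : exists2 e, 0 < e & ~ finely_covered f (2 * e) setT.
    apply: contrapT => nex; apply/nbf/countably_fine_baire_class1 => e e0.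
    apply: contrapT => nfc; apply: nex; exists (e / 2); first by rewrite divr_gt0.
    by rewrite mulrC divfK.
  have [F F0 jF] := not_finely_covered_jump e0 sX nfc.
  exact: I_wins_of_jumps e0 F0 jF.
have nb := @not_both_win _ _ _ f.
have [bf|nbf] := pselect (baire_class1 f).
  by split; [right; exact: winII|split; split=> // /nb/(_ (winII bf))].
by split; [left; exact: winI|split; split=> // /(nb (winI nbf))].
Qed.
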